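(* Let $\theta>2$ be a non-integer real number and let $\tau>0$. Let $s\ge 2$ be an integer and let $c$ be a fixed real constant with $0\le c<(\lfloor s/2\rfloor(\theta-1))^{-1/2}$. Then there exists an infinite strictly increasing sequence of non-negative real numbers $\{R_n\}_{n=1}^\infty$ with $R_n\to\infty$ as $n\to\infty$ such that, with $X_n=(R_n/s)^{1/\theta}$, $$N_{s,\theta}^{\tau}(R_n,c\sqrt{X_n})=0\quad\text{for every } n.$$
   Context: For $s\in\mathbb{N}$, $\theta>2$ non-integer, $\tau>0$, $R>0$ real, $X=(R/s)^{1/\theta}$ and $0\le Y\le X$, the quantity $N_{s,\theta}^{\tau}(R,Y)$ is the number of $s$-tuples of positive integers $(x_1,\ldots,x_s)$ satisfying $$|x_1^\theta+\cdots+x_s^\theta-R|<\tau \quad\text{and}\quad X-Y<x_i\le X+Y\quad (1\le i\le s).$$ (When $Y=c\sqrt X$ with $c$ fixed, the condition $Y\le X$ holds for all large $R$.) *)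

(* Defs.v *)
From HB Require Import structures.
From mathcomp Require Import all_boot all_order all_algebra.
From mathcomp Require Import finmap.
From mathcomp Require Import all_classical all_reals all_analysis.

Import Order.TTheory GRing.Theory Num.Theory.
Import numFieldNormedType.Exports.

Local Open Scope classical_set_scope.
Local Open Scope ring_scope.

Definition window_center {R : realType} (s : nat) (theta r : R) : R :=
  (r / s%:R) `^ theta^-1.

Definition solutions {R : realType} (s : nat) (theta tau r Y : R) :
    set (s.-tuple nat) :=
  [set x | [/\ forall i, (0 < tnth x i)%N,
     `|(\sum_(i < s) (tnth x i)%:R `^ theta) - r| < tau &
     forall i, window_center s theta r - Y < (tnth x i)%:R
                 <= window_center s theta r + Y]].

(* [fset_set] sends infinite sets to [fset0]; [finite_solutions] shows that
   this default value is never used in [nb_solutions]. *)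
Lemma finite_solutions {R : realType} (s : nat) (theta tau r Y : R) :
  finite_set (solutions s theta tau r Y).
Proof.
pose M := Num.truncn (window_center s theta r + Y).
apply: (@sub_finite_set _ _
  ((fun t : s.-tuple 'I_M.+1 => [tuple of map val t]) @` setT)); last first.
  exact/finite_image/finite_finset.
move=> x [_ _ xXY].
exists [tuple inord (tnth x i) | i < s] => //.
apply: eq_from_tnth => i; rewrite tnth_map tnth_mktuple /= inordK //.
have /andP[_ le_x] := xXY i.
by rewrite -(ltr_nat R); apply: le_lt_trans le_x _; exact: truncnS_gt.
Qed.

Definition nb_solutions {R : realType} (s : nat) (theta tau r Y : R) : nat :=
  #|` fset_set (solutions s theta tau r Y)|%fset.

(* Main.v *)
(* Take [X] with [s * X = k + delta], [k] an integer and [q < delta < 1], where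
   [q = (s %/ 2) (theta - 1) c ^ 2 < 1], and write [x_i = X (1 + u_i)].  After
   division by [theta * X ^ (theta - 1)], the difference between the sum of the
   [x_i ^ theta] and [s * X ^ theta] is, up to an error tending to [0],
     [sigma + (theta - 1) / 2 * X * \sum_i u_i ^ 2]
   with [sigma = \sum_i x_i - s * X].  As [sigma + delta] is an integer, either
   [sigma >= 1 - delta], and convexity makes the sum too large, or
   [sigma <= - delta], and the sum is too small since the quadratic term is at
   most [q] plus a small multiple of [- sigma]. *)

Require Import Defs.
From HB Require Import structures.
From mathcomp Require Import all_boot all_order all_algebra.
From mathcomp Require Import all_classical all_reals all_analysis.
From mathcomp Require Import ring lra zify.

Import Order.TTheory GRing.Theory Num.Theory.
Import numFieldNormedType.Exports.

Local Open Scope classical_set_scope.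
Local Open Scope ring_scope.

(** [a] and [x] come in either order: the sign condition and the distance bound together place [z]
    between them, in a form that later products can use directly. *)
Lemma MVT_gt0 (R : realType) (f df : R -> R) (a x : R) :
  (forall y : R, 0 < y -> is_derive y 1 f (df y)) -> 0 < a -> 0 < x ->
  exists z, [/\ 0 < z, 0 <= (z - a) * (x - a), `|z - a| <= `|x - a| &
                f x - f a = df z * (x - a)].
Proof.
move=> fdf a0 x0.
have fC (u v : R) : 0 < u -> {within `[u, v], continuous f}.
  move=> u0; apply: continuous_in_subspaceT => y /set_mem/=.
  rewrite in_itv/= => /andP[uy _]; have y0 := lt_le_trans u0 uy.
  have := fdf y y0 => fy.
  by apply: differentiable_continuous; apply/derivable1_diffP.
have fD (u v : R) : 0 < u -> forall y : R, y \in `]u, v[%R ->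
    is_derive y 1 f (df y).
  by move=> u0 y; rewrite in_itv/= => /andP[uy _]; exact/fdf/(lt_trans u0).
have [ax|xa|->] := ltgtP a x.
- have [z /[!in_itv]/= /andP[az zx] E] := MVT ax (fD _ _ a0) (fC _ _ a0).
  exists z; split=> //; [lra|by nra|by rewrite !ger0_norm; lra].
- have [z /[!in_itv]/= /andP[xz za] E] := MVT xa (fD _ _ x0) (fC _ _ x0).
  exists z; split=> //; [lra|by nra|by rewrite !ler0_norm; lra|lra].
- by exists x; split; rewrite // ?subrr ?mulr0.
Qed.

(** By the mean value theorem the increment from [1] is [p * z ^ (p - 1) * (x - 1)], and
    [z ^ (p - 1) - 1] never has the sign opposite to [x - 1]. *)
Lemma powR_Bernoulli (R : realType) (p x : R) : 1 <= p -> 0 < x ->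
  1 + p * (x - 1) <= x `^ p.
Proof.
move=> p1 x0.
have [z [z0 zx _]] :=
  @MVT_gt0 R _ _ 1 x (fun y => @is_derive1_powR R p y) ltr01 x0.
rewrite /= powR1 => E.
suff : 0 <= p * ((z `^ (p - 1) - 1) * (x - 1)) by lra.
apply: mulr_ge0; first lra.
have mono (u v : R) : 0 < u -> u <= v -> u `^ (p - 1) <= v `^ (p - 1).
  by move=> u0 uv; apply: ge0_ler_powR; rewrite ?nnegrE; lra.
have [x1|x1|->] := ltgtP x 1; last by rewrite subrr mulr0.
- have z1 : z <= 1 by nra.
  by have := mono _ _ z0 z1; rewrite powR1; nra.
- have z1 : 1 <= z by nra.
  by have := mono _ _ ltr01 z1; rewrite powR1; nra.
Qed.

(** Two mean value steps replace a second-order Taylor formula; the second derivative of the power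
    is controlled on the whole range because [p - 2 >= 0]. *)
Lemma powR_le_quadratic (R : realType) (p a x : R) : 2 <= p -> 0 < x ->
  `|x - 1| <= a ->
  x `^ p <=
    1 + p * (x - 1) + p * (p - 1) / 2 * (1 + a) `^ (p - 2) * (x - 1) ^+ 2.
Proof.
move=> p2 x0 xa; set A := (1 + a) `^ (p - 2).
pose f y : R := y `^ p - p * y - p * (p - 1) / 2 * A * (y - 1) ^+ 2.
pose df y : R := p * y `^ (p - 1) - p - p * (p - 1) * A * (y - 1).
have fdf (y : R) : 0 < y -> is_derive y 1 f (df y).
  move=> y0; have := is_derive1_powR p y0 => yp.
  rewrite /f /df; apply: is_derive_eq; rewrite /GRing.scale/=; lra.
have [z [z0 zx zxa]] := @MVT_gt0 R _ _ 1 x fdf ltr01 x0.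
have [w [w0 _ wz]] :=
  @MVT_gt0 R _ _ 1 z (fun y => @is_derive1_powR R (p - 1) y) ltr01 z0.
rewrite /f /df /= !powR1 => Ez Ex.
have Aw : w `^ (p - 1 - 1) <= A.
  rewrite /A; have -> : p - 1 - 1 = p - 2 by lra.
  have w1 : w - 1 <= a by apply: le_trans (ler_norm _) _; lra.
  by apply: ge0_ler_powR; rewrite ?nnegrE; lra.
(* This product equals [f 1 - f x]. *)
have : 0 <= p * (p - 1) * (A - w `^ (p - 1 - 1)) * ((z - 1) * (x - 1)).
  by apply: mulr_ge0 => //; apply: mulr_ge0; [nra|lra].
have -> : p * (p - 1) * (A - w `^ (p - 1 - 1)) * ((z - 1) * (x - 1)) =
  p * (p - 1) * A * (z - 1) * (x - 1)
  - p * ((p - 1) * w `^ (p - 1 - 1) * (z - 1)) * (x - 1) by ring.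
rewrite -Ez; lra.
Qed.

(* The nonnegative and the negative [u i] contribute [P] and [- N] to the sum,
   [P + N = 2 * min(P, N) + `|P - N|], and one of the two groups has at most
   [s %/ 2] members. *)
Lemma sum_sqr_le (R : realType) (s : nat) (u : 'I_s -> R) (a : R) : 0 <= a ->
  (forall i, `|u i| <= a) ->
  \sum_i u i ^+ 2 <= (s %/ 2)%:R * 2 * a ^+ 2 + `|\sum_i u i| * a.
Proof.
move=> a0 ua.
have sqa : \sum_i u i ^+ 2 <= a * \sum_i `|u i|.
  rewrite mulr_sumr; apply: ler_sum => i _.
  by rewrite -real_normK ?num_real// expr2 ler_wpM2r.
apply: le_trans sqa _.
suff : \sum_i `|u i| <= (s %/ 2)%:R * 2 * a + `|\sum_i u i| by nra.
pose p : pred 'I_s := fun i => 0 <= u i.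
pose P := \sum_(i | p i) `|u i|; pose N := \sum_(i | ~~ p i) `|u i|.
have PN : \sum_i `|u i| = P + N by rewrite (bigID p).
have uPN : \sum_i u i = P - N.
  rewrite (bigID p)/= /P /N -sumrN; congr (_ + _); apply: eq_bigr => i.
    by move=> /ger0_norm.
  by rewrite -ltNge => /ltr0_norm ->; rewrite opprK.
have card_le (q : pred 'I_s) : \sum_(i | q i) `|u i| <= #|q|%:R * a.
  by rewrite mulr_natl -sumr_const; exact: ler_sum.
have := cardC p; rewrite card_ord => pC.
have [ps|ps] := leqP #|p| (s %/ 2).
  have Pa : P <= (s %/ 2)%:R * a.
    by apply: le_trans (card_le _) _; rewrite ler_wpM2r// ler_nat.
  by have := ler_norm (- (P - N)); rewrite normrN PN uPN; lra.
have Na : N <= (s %/ 2)%:R * a.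
  apply: le_trans (card_le _) _; rewrite ler_wpM2r// ler_nat.
  (* At least [s %/ 2 + 1] indices satisfy [p], which leaves at most [s - s %/ 2 - 1 <= s %/ 2]
     others. *)
  suff : (#|[predC p]| <= s %/ 2)%N by [].
  rewrite -(leq_add2l #|p|) pC {1}(divn_eq s 2); move: ps.
  by rewrite modn2; lia.
by have := ler_norm (P - N); rewrite PN uPN; lra.
Qed.

Lemma window_center_powR (R : realType) (s : nat) (theta X : R) :
  (0 < s)%N -> theta != 0 -> 0 <= X ->
  window_center s theta (s%:R * X `^ theta) = X.
Proof.
move=> s0 theta0 X0; rewrite /window_center mulrAC mulfV ?pnatr_eq0 -?lt0n//.
by rewrite mul1r -powRrM mulfV// powRr1.
Qed.

(** The last three hypotheses say how large [X] must be; [a] is the half-width of the window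
    relative to [X]. As [delta] is the midpoint of [q] and [1], both cases of the argument have the
    same margin [1 - delta = delta - q = (1 - q) / 2]. *)
Lemma solutions_eq0 (R : realType) (s k : nat) (theta tau c q X : R) :
  let delta := (1 + q) / 2 in
  let a := c / Num.sqrt X in
  (0 < s)%N -> 2 < theta -> 0 <= c ->
  q = (s %/ 2)%:R * (theta - 1) * c ^+ 2 -> q < 1 -> 1 <= X ->
  s%:R * X = k%:R + delta -> a < 1 -> tau <= X * ((1 - q) / 4) ->
  (1 + a) `^ (theta - 2) * (q + delta * (theta - 1) * a / 2) <=
    (delta + q) / 2 ->
  solutions s theta tau (s%:R * X `^ theta)
    (c * Num.sqrt (window_center s theta (s%:R * X `^ theta))) = set0.
Proof.
move=> delta a s0 theta2 c0 qE q1 X1 sX a1 tauX Aq.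
have X0 : 0 < X by lra.
have sqX0 : 0 < Num.sqrt X by rewrite sqrtr_gt0.
have sqXX : Num.sqrt X ^+ 2 = X by rewrite sqr_sqrtr//; lra.
have q0 : 0 <= q by rewrite qE !mulr_ge0// ?sqr_ge0//; lra.
have a0 : 0 <= a by rewrite divr_ge0// ltW.
have aX : a * X = c * Num.sqrt X by rewrite -[in LHS]sqXX /a; field; lra.
have a2X : X * a ^+ 2 = c ^+ 2 by rewrite -[in LHS]sqXX /a; field; lra.
rewrite /solutions window_center_powR//; [|lra|lra].
apply/seteqP; split=> // x [_ xtau xX]; exfalso.
pose y i : R := (tnth x i)%:R / X; pose u i := y i - 1.
have xE i : (tnth x i)%:R = X * y i by rewrite /y; field; lra.
have ua i : `|u i| <= a.
  have /andP[] := xX i; rewrite -aX xE /u ler_norml => lo hi.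
  by apply/andP; split; rewrite -(ler_pM2l X0) mulrBr ?mulrN; lra.
have y0 i : 0 < y i by have := ua i; rewrite /u ler_norml => /andP[lo _]; lra.
(* [X * D] is the deviation divided by [X ^ (theta - 1)]; the factor [theta] is kept. *)
pose D := \sum_i (y i `^ theta - 1).
have sumE : \sum_(i < s) (tnth x i)%:R `^ theta - s%:R * X `^ theta =
    X `^ theta * D.
  rewrite /D sumrB big_const_ord iter_addr addr0 mulrBr mulr_natr mulr_natl.
  congr (_ - _); rewrite mulr_sumr; apply: eq_bigr => i _.
  by rewrite xE powRM// ltW.
have XD : `|X * D| < (1 - q) / 4.
  (* Since [X >= 1] and [theta > 2], [X ^ 2 * |D|] is at most the deviation [X ^ theta * |D|]. *)
  rewrite -(ltr_pM2l X0); apply: lt_le_trans tauX; apply: le_lt_trans xtau.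
  rewrite sumE !normrM (ger0_norm (powR_ge0 _ _)) (gtr0_norm X0).
  rewrite mulrA ler_wpM2r// -expr2 -powR_mulrn; last lra.
  by apply: ler_powR; lra.
pose m := (\sum_(i < s) tnth x i)%N.
pose sigma : R := m%:R - k%:R - delta.
have sigmaE : X * \sum_i u i = sigma.
  rewrite /u sumrB big_const_ord iter_addr addr0 mulrBr mulr_sumr.
  rewrite -(eq_bigr _ (fun i _ => xE i)) -natr_sum -/m /sigma -addrA -opprD -sX.
  by rewrite mulr_natr mulr_natl.
move: XD; rewrite ltr_norml => /andP[XD_lo XD_hi].
have [mk|km] := leqP m k; last first.
  have sigma_ge : 1 - delta <= sigma.
    have : (k.+1%:R : R) <= m%:R by rewrite ler_nat.
    by rewrite -natr1 /sigma; lra.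
  have DE : theta * \sum_i u i <= D.
    rewrite mulr_sumr; apply: ler_sum => i _.
    by have := @powR_Bernoulli R theta (y i) ltac:(lra) (y0 i); rewrite /u; lra.
  have : theta * sigma <= X * D by rewrite -sigmaE mulrCA ler_pM2l.
  rewrite /delta in sigma_ge *; nra.
have sigma_le : sigma <= - delta.
  have : (m%:R : R) <= k%:R by rewrite ler_nat.
  by rewrite /sigma; lra.
have delta0 : 0 < delta by rewrite /delta; lra.
set A := (1 + a) `^ (theta - 2) in Aq.
have A0 : 0 <= A by exact: powR_ge0.
have DE : D <= theta * \sum_i u i +
               theta * (theta - 1) / 2 * A * \sum_i u i ^+ 2.
  rewrite !mulr_sumr -big_split/=; apply: ler_sum => i _.
  have := @powR_le_quadratic R theta a (y i) ltac:(lra) (y0 i) (ua i).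
  by rewrite /u /A; lra.
have normE : X * `|\sum_i u i| = - sigma.
  by rewrite -[X in X * _](gtr0_norm X0) -normrM sigmaE ltr0_norm//; lra.
have sqE : X * \sum_i u i ^+ 2 <= (s %/ 2)%:R * 2 * c ^+ 2 - sigma * a.
  have := ler_wpM2l (ltW X0) (@sum_sqr_le R s u a a0 ua).
  by rewrite mulrDr (mulrA X `|_|) normE (mulrCA X) a2X mulNr.
(* The term [- sigma * a] of [sqE] feeds back into the linear term, whose coefficient drops from [1]
   to [1 - B]; this must stay positive for [sigma <= - delta] to be usable. *)
pose B := (theta - 1) / 2 * A * a.
have K0 : 0 <= theta * (theta - 1) / 2 * A by rewrite !mulr_ge0//; lra.
have : X * D <= theta * (sigma * (1 - B) + A * q).
  have XD_le := ler_wpM2l (ltW X0) DE.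
  rewrite mulrDr (mulrCA X theta) sigmaE (mulrCA X (_ / 2 * A)) in XD_le.
  have := ler_wpM2l K0 sqE; rewrite qE /B; lra.
have Aq' : A * q + delta * B <= (delta + q) / 2.
  by move: Aq; rewrite /B; lra.
have B1 : B < 1 by have := mulr_ge0 A0 q0; rewrite /delta in Aq' delta0 *; nra.
have : sigma * (1 - B) + A * q <= - ((1 - q) / 4).
  rewrite /delta in sigma_le Aq' *; nra.
nra.
Qed.

(** Used with [t = 1 / sqrt X], so that [c * t] is the [a] of [solutions_eq0]. The expression is
    continuous at [t = 0], with value [q] there. *)
Lemma powR_quadratic_error_small (R : realType) (c p q d e : R) : q < e ->
  exists2 eps : R, 0 < eps & forall t, 0 <= t -> t < eps ->
    c * t < 1 /\ (1 + c * t) `^ p * (q + d * (c * t)) <= e.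
Proof.
move=> qe.
pose G (t : R) := (1 + c * t) `^ p * (q + d * (c * t)).
have ct : c * t @[t --> (0 : R)] --> c * 0.
  by apply: cvgM; [exact: cvg_cst|exact: cvg_id].
have G0 : G t @[t --> (0 : R)] --> q.
  have -> : q = (1 + c * 0) `^ p * (q + d * (c * 0)).
    by rewrite !mulr0 !addr0 powR1 mul1r.
  apply: cvgM; last first.
    by apply: cvgD; [exact: cvg_cst|apply: cvgM => //; exact: cvg_cst].
  have c1 : {for (1 + c * 0 : R), continuous (@powR R ^~ p)}.
    rewrite mulr0 addr0; have := @is_derive1_powR R p 1 ltr01 => d1.
    by apply: differentiable_continuous; apply/derivable1_diffP.
  have ct1 : 1 + c * t @[t --> (0 : R)] --> 1 + c * 0.
    by apply: cvgD => //; exact: cvg_cst.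
  exact: (cvg_comp _ _ ct1 c1).
have : \forall t \near (0 : R), c * t < 1 /\ G t <= e.
  near=> t; split; near: t.
    by apply: cvgr_lt ct _ _; rewrite mulr0.
  exact: cvgr_le G0 _ qe.
move=> /nbhs_ballP[eps/= eps0 epsP]; exists eps => // t t0 teps.
by apply: epsP; rewrite /ball/= sub0r normrN ger0_norm.
Unshelve. all: by end_near. Qed.

Theorem theorem2 (R : realType) (theta tau : R) (s : nat) (c : R)
    (theta_gt2 : 2 < theta) (theta_nint : theta \isn't a Num.int)
    (tau_gt0 : 0 < tau) (s_ge2 : (2 <= s)%N)
    (c_ge0 : 0 <= c)
    (c_lt : c < ((s %/ 2)%:R * (theta - 1)) `^ (- 2^-1)) :
  exists r : nat -> R,
    [/\ increasing_seq r,
        forall n, 0 <= r n,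
        r @ \oo --> +oo &
        forall n, nb_solutions s theta tau (r n)
                    (c * Num.sqrt (window_center s theta (r n))) = 0%N].
Proof.
have s0 : (0 < s)%N by exact: leq_trans s_ge2.
pose K : R := (s %/ 2)%:R * (theta - 1).
have f1 : (1 : R) <= (s %/ 2)%:R by rewrite ler1n divn_gt0.
have K0 : 0 < K by rewrite mulr_gt0//; lra.
pose q := K * c ^+ 2; pose delta := (1 + q) / 2.
have q0 : 0 <= q by rewrite mulr_ge0 ?sqr_ge0 ?ltW.
have q1 : q < 1.
  (* The bound on [c] reads [c * sqrt K < 1], and [q] is the square of the left side. *)
  move: c_lt; rewrite -/K powRN powR12_sqrt ?(ltW K0)// => cK.
  have sK0 : 0 < Num.sqrt K by rewrite sqrtr_gt0.
  have cK1 : c * Num.sqrt K < 1 by rewrite -ltr_pdivlMr// mul1r.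
  rewrite /q -(sqr_sqrtr (ltW K0)) mulrC -exprMn.
  by rewrite expr_lt1// mulr_ge0// ltW.
have [eps eps0 epsP] := @powR_quadratic_error_small R c (theta - 2) q
  (delta * (theta - 1) / 2) ((delta + q) / 2) ltac:(rewrite /delta; lra).
(* The summands ensure, in turn, [1 <= X], [1 / sqrt X < eps] and [tau <= X * ((1 - q) / 4)]. The
   integer [n0] exceeds [s * X0], and [s * X n] runs through the numbers [n0 + n + delta]. *)
pose X0 : R := 1 + (eps^-1 + 1) ^+ 2 + 4 * tau / (1 - q).
pose n0 := (Num.truncn (s%:R * X0)).+1.
pose X n : R := ((n0 + n)%:R + delta) / s%:R.
have sR0 : (0 : R) < s%:R by rewrite ltr0n.
have sX n : s%:R * X n = (n0 + n)%:R + delta by rewrite /X mulrC divfK// gt_eqF.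
have e0 : 0 < eps^-1 by rewrite invr_gt0.
have tq0 : 0 < 4 * tau / (1 - q) by rewrite divr_gt0//; lra.
have XX0 n : X0 <= X n.
  rewrite -(ler_pM2l sR0) sX; have := truncnS_gt (s%:R * X0); rewrite -/n0.
  have : (n0%:R : R) <= (n0 + n)%:R by rewrite ler_nat leq_addr.
  by rewrite /delta; lra.
have X1 n : 1 <= X n by have := XX0 n; rewrite /X0; nra.
have X_lt m n : (m < n)%N -> X m < X n.
  move=> mn; rewrite ltr_pM2r ?invr_gt0// ltrD2r ltr_nat.
  by rewrite ltn_add2l.
have ler_r n : n%:R <= s%:R * X n `^ theta.
  apply: (@le_trans _ _ (s%:R * X n)).
    by rewrite sX natrD; have : (0 : R) <= n0%:R by []; rewrite /delta; lra.
  by rewrite ler_pM2l// le1r_powR//; lra.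
exists (fun n => s%:R * X n `^ theta); split.
- apply: le_mono => m n mn; rewrite ltr_pM2l//.
  apply: gt0_ltr_powR; rewrite ?nnegrE ?X_lt//; [lra| |].
    by have := X1 m; lra.
  by have := X1 n; lra.
- by move=> n; rewrite mulr_ge0// powR_ge0.
- apply/cvgryPge => M; near=> n; apply: le_trans (ler_r n).
  by near: n; exact: nbhs_infty_ger.
- move=> n; rewrite /nb_solutions.
  have Xn := X1 n.
  have sqX : eps^-1 < Num.sqrt (X n).
    rewrite -(gtr0_norm e0) -sqrtr_sqr ltr_sqrt; last lra.
    by have := XX0 n; rewrite /X0; nra.
  have teps : (Num.sqrt (X n))^-1 < eps.
    by rewrite -[ltRHS]invrK ltf_pV2 ?posrE// (lt_trans e0).
  have t0 : 0 <= (Num.sqrt (X n))^-1 by rewrite invr_ge0 sqrtr_ge0.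
  have [ct Gt] := epsP _ t0 teps.
  rewrite (@solutions_eq0 R s (n0 + n) theta tau c q)//.
  + by rewrite fset_set0 finmap.cardfs0.
  + have XXn := XX0 n; rewrite -ler_pdivrMr; last lra.
    have -> : tau / ((1 - q) / 4) = 4 * tau / (1 - q) by field; lra.
    by have := sqr_ge0 (eps^-1 + 1); rewrite /X0 in XXn; lra.
  + by apply: le_trans Gt; rewrite -/delta; lra.
Unshelve. all: by end_near. Qed.
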